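(* Let $n$ and $q$ be integers with $n\geq 2$ and $q\geq 2$. Let $C(n,q)$ be the maximum number of codewords in a non-overlapping $q$-ary code of length $n$. Then \[ C(n,q)<\frac{q^n}{2n-1}. \]
   Context: Let $F$ be a finite alphabet with $|F|=q$. Two words $u,v\in F^n$ (not necessarily distinct) are overlapping if a non-empty proper prefix of $u$ equals a non-empty proper suffix of $v$, or a non-empty proper prefix of $v$ equals a non-empty proper suffix of $u$. A code $C\subseteq F^n$ is non-overlapping if for all (not necessarily distinct) $u,v\in C$, the words $u$ and $v$ are not overlapping. $C(n,q)$ denotes the maximum cardinality of a non-overlapping code $C\subseteq F^n$ with $|F|=q$. *)

(* Defs.v *)
From mathcomp Require Import all_boot.

Set Implicit Arguments.
Unset Strict Implicit.
Unset Printing Implicit Defensive.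

(* The common factor is an explicit word w of length 0 < k < n, i.e. non-empty
   and proper in both u and v; quantifying over tuples keeps this boolean. *)
Definition prefix_meets_suffix (F : finType) (n : nat) (u v : n.-tuple F) : bool :=
  [exists k : 'I_n, (0 < k) &&
    [exists w : k.-tuple F, prefix w u && suffix w v]].

Definition overlapping (F : finType) (n : nat) (u v : n.-tuple F) : bool :=
  prefix_meets_suffix u v || prefix_meets_suffix v u.

(* The case u = v is included. *)
Definition non_overlapping (F : finType) (n : nat) (C : {set n.-tuple F}) : bool :=
  [forall u in C, forall v in C, ~~ overlapping u v].

(* C(n, q) for q = #|F|; it depends on F only through #|F|. The maximum is over
   a non-empty family, since the empty code is non-overlapping. *)
Definition max_non_overlapping (F : finType) (n : nat) : nat :=
  \max_(C : {set n.-tuple F} | non_overlapping C) #|C|.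

(* Main.v *)
Require Import Defs.
From mathcomp Require Import all_boot all_order all_algebra.
Import Order.TTheory GRing.Theory Num.Theory.
Local Open Scope ring_scope.

(** Write a codeword [c] followed by [n - 1] arbitrary letters [d] on a circle of
    length [2n - 1], starting at position [i]. Any two distinct windows of length
    [n] on this circle meet in a proper non-empty arc, one end of the first being
    the beginning of the second; so the circular word determines [(c, d, i)].
    Constant words are not obtained, since a constant word of length [n >= 2]
    overlaps itself. Hence [(2n - 1) |C| q ^ (n - 1) < q ^ (2n - 1)]. *)

Lemma prefix_meets_suffixI {F : finType} {n : nat} {u v : n.-tuple F} (w : seq F) :
  (0 < size w < n)%N -> prefix w u -> suffix w v -> prefix_meets_suffix u v.
Proof.
case/andP=> w_gt0 w_ltn pwu swv; apply/existsP; exists (Ordinal w_ltn).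
by rewrite w_gt0; apply/existsP; exists (in_tuple w); rewrite pwu.
Qed.

Lemma non_overlappingP {F : finType} {n : nat} {C : {set n.-tuple F}} :
  non_overlapping C -> {in C &, forall u v, ~~ prefix_meets_suffix u v}.
Proof.
move=> /forall_inP nC u v uC vC.
by have /forall_inP/(_ v vC) := nC u uC; rewrite negb_or => /andP[].
Qed.

(** The common factor is [drop k v]: a rotation by [k < n] brings these last [n - k] letters of [v]
    to the front, where [u] starts. *)
Lemma rot_prefix_meets_suffix {F : finType} {n : nat} {u v : n.-tuple F}
    {s t : seq F} {k : nat} :
  (0 < k < n)%N -> u ++ s = rot k (v ++ t) -> prefix_meets_suffix u v.
Proof.
case/andP=> k_gt0 k_ltn e.
apply: (prefix_meets_suffixI (drop k v)).
- by rewrite size_drop size_tuple subn_gt0 k_ltn ltn_subrL k_gt0 (ltn_trans k_gt0).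
- have sz : (size (drop k v) <= size u)%N by rewrite size_drop !size_tuple leq_subr.
  rewrite prefixE -(takel_cat s sz) e /rot drop_cat size_tuple k_ltn -catA.
  by rewrite take_size_cat.
- exact: suffix_drop.
Qed.

(** Since [rot] shifts to the left, the codeword begins at position [- x.2] modulo [n + m]. *)
Definition circular {F : finType} {n m : nat}
    (x : n.-tuple F * m.-tuple F * 'I_(n + m)) : (n + m).-tuple F :=
  [tuple of rot x.2 [tuple of x.1.1 ++ x.1.2]].

Lemma circular_inj {F : finType} {n m : nat} {C : {set n.-tuple F}} :
  (m < n)%N -> non_overlapping C ->
  {in [pred x | x.1.1 \in C] &, injective (@circular F n m)}.
Proof.
move=> m_ltn nC [[c d] i] [[c' d'] j].
wlog le_ij : c d i c' d' j / (i <= j)%N.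
  move=> IH; case/orP: (leq_total i j) => le_ij; first exact: IH.
  by move=> cC c'C e; apply/esym; apply: IH.
rewrite !inE /= => cC c'C /(congr1 val) /= e.
have size_cd : size (c ++ d) = (n + m)%N by rewrite size_cat !size_tuple.
have size_cd' : size (c' ++ d') = (n + m)%N by rewrite size_cat !size_tuple.
pose k := (j - i)%N.
have k_lt : (k < n + m)%N by apply: leq_ltn_trans (leq_subr _ _) (ltn_ord j).
(* Undoing the rotation by [i] on both sides leaves only the relative shift [k]. *)
have ek : c ++ d = rot k (c' ++ d').
  by apply: (can_inj (rotK i)); rewrite e -rotD /k subnKC // size_cd' ltnW.
have [k0|k_gt0] := posnP k.
  move: ek; rewrite k0 rot0 => /eqP; rewrite eqseq_cat ?size_tuple //.
  case/andP=> /eqP/val_inj -> /eqP/val_inj ->; congr (_, _).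
  by apply/val_inj/eqP; rewrite eqn_leq le_ij -subn_eq0 -/k k0.
have [k_ltn|n_lek] := ltnP k n.
  have : prefix_meets_suffix c c' by apply: rot_prefix_meets_suffix ek; rewrite k_gt0.
  by rewrite (negPf (non_overlappingP nC c c' cC c'C)).
(* When [n <= k], go around the circle the other way: the shift [n + m - k] is at most [m], hence
   less than [n], and the two codewords exchange roles. *)
have ek' : c' ++ d' = rot (n + m - k) (c ++ d).
  by rewrite ek -{1}(rotK k (c' ++ d')) /rotr size_rot size_cd'.
have : prefix_meets_suffix c' c.
  apply: rot_prefix_meets_suffix ek'; rewrite subn_gt0 k_lt /=.
  by apply: leq_ltn_trans m_ltn; rewrite leq_subLR leq_add2r.
by rewrite (negPf (non_overlappingP nC c' c c'C cC)).
Qed.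

Lemma circular_nseq {F : finType} {n m : nat} (a : F)
    (x : n.-tuple F * m.-tuple F * 'I_(n + m)) :
  circular x = [tuple of nseq (n + m) a] -> x.1.1 = [tuple of nseq n a].
Proof.
move=> /(congr1 val) /= /(congr1 (rotr x.2)); rewrite rotK => e.
have : all (pred1 a) (x.1.1 ++ x.1.2).
  by rewrite e /rotr /rot all_cat andbC -all_cat cat_take_drop all_pred1_nseq.
rewrite all_cat => /andP[/all_pred1P ea _].
by apply: val_inj; rewrite /= ea size_tuple.
Qed.

Lemma nseq_overlap {F : finType} {n : nat} (a : F) : (1 < n)%N ->
  prefix_meets_suffix [tuple of nseq n a] [tuple of nseq n a].
Proof.
case: n => [|n] // n_gt0; apply: (prefix_meets_suffixI [:: a]) => //.
  exact: (prefix_prefix [:: a] (nseq n a)).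
suff : suffix (nseq 1 a) (nseq n.+1 a) by [].
by rewrite -[n.+1]addn1 nseqD suffix_suffix.
Qed.

Lemma non_overlapping_card {F : finType} {n : nat} {C : {set n.+1.-tuple F}} :
  (0 < n)%N -> (0 < #|F|)%N -> non_overlapping C ->
  (#|C| * (n.+1 + n) < #|F| ^ n.+1)%N.
Proof.
move=> n_gt0 F_gt0 nC; have /card_gt0P[a _] := F_gt0.
pose cst := [tuple of nseq (n.+1 + n) a].
pose D := setX (setX C [set: n.-tuple F]) [set: 'I_(n.+1 + n)].
(* Missing a single constant word is what makes the final inequality strict. *)
have sub : circular @: D \subset [set~ cst].
  apply/subsetP => _ /imsetP[x + ->]; rewrite !inE !andbT => xC.
  apply: contraTneq (nseq_overlap a (n_gt0 : 1 < n.+1)%N) => /circular_nseq ec.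
  by apply: (non_overlappingP nC); rewrite -ec.
have := subset_leq_card sub.
rewrite card_in_imset; last first.
  move=> x y; rewrite !inE !andbT => xC yC.
  exact: (circular_inj (ltnSn n) nC).
rewrite !cardsX !cardsT card_ord cardsC1 !card_tuple => le_card.
have : (#|C| * #|F| ^ n * (n.+1 + n) < #|F| ^ (n.+1 + n))%N.
  by apply: leq_ltn_trans le_card _; rewrite prednK // expn_gt0 F_gt0.
(* The factor [#|F| ^ n] counting the free letters cancels. *)
by rewrite expnD mulnAC ltn_pmul2r // expn_gt0 F_gt0.
Qed.

Theorem theorem1 (n q : nat) (F : finType)
    (hn : (2 <= n)%N) (hq : (2 <= q)%N) (hF : #|F| = q) :
  (max_non_overlapping F n)%:R < q%:R ^+ n / (2 * n%:R - 1) :> rat.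
Proof.
case: n hn => [|n] // n_gt0.
have F_gt0 : (0 < #|F|)%N by rewrite hF ltnW.
have -> : 2 * n.+1%:R - 1 = (n.+1 + n)%:R :> rat.
  by rewrite mulr_natl mulr2n -addrA -[X in _ - X]/(1%:R) -natrB // subn1 -natrD.
rewrite ltr_pdivlMr ?ltr0n // -natrM -natrX ltr_nat -hF /max_non_overlapping.
(* The strict bound holds for the neutral value 0 and passes to the maximum of two numbers, so each
   code can be treated separately. *)
elim/big_ind: _ => [|x y|C]; first by rewrite mul0n expn_gt0 F_gt0.
  by rewrite /maxn; case: ifP.
exact: non_overlapping_card.
Qed.
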